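(* Let $P$ be a $2$-regular $(n,n,z,\mathcal{S})$ placement delivery array (PDA) with associated graph $G(P)$. Suppose $G(P)$ has an $r$-regular spanning subgraph whose $nr/2$ edges are $\{e(s): s\in\mathcal{S}_r\}$, where $\mathcal{S}_r\subset\mathcal{S}$. Then the array obtained from $P$ by replacing every entry equal to some $s\in\mathcal{S}_r$ by $\ast$ is a $2$-regular $(n,n,z+r,\mathcal{S}\setminus\mathcal{S}_r)$ PDA.
   Context: Notation: $[n]=\{0,1,\dots,n-1\}$. For positive integers $K,f$, a nonnegative integer $Z$ and a finite set $\mathcal{S}$ of integers, a $(K,f,Z,\mathcal{S})$ placement delivery array (PDA) is an $f\times K$ array $P=[p_{j,k}]$, $j\in[f]$, $k\in[K]$, with entries in $\mathcal{S}\cup\{\ast\}$ such that: (C1) $\ast$ appears exactly $Z$ times in each column; (C2) each $s\in\mathcal{S}$ occurs at least once; (C3, Blackburn property) if two distinct cells $(j_1,k_1)$, $(j_2,k_2)$ contain the same integer then $p_{j_1,k_2}=p_{j_2,k_1}=\ast$. The PDA is $g$-regular if each integer of $\mathcal{S}$ occurs exactly $g$ times. Associated graph: for a $2$-regular $(n,n,Z,\mathcal{S})$ PDA $P$ in which $s\in\mathcal{S}$ occurs at cells $(i_1(s),j_1(s))$ and $(i_2(s),j_2(s))$, $G(P)$ is the graph with vertex set $\{0,\dots,n-1\}$ (the columns of $P$) having one labelled undirected edge $e(s)$ joining $j_1(s)$ and $j_2(s)$ for each $s\in\mathcal{S}$ (edges for different $s$ are regarded as different edges, even if parallel). A spanning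 subgraph has the same vertex set and a subset of the edges, with no isolated vertices; it is $r$-regular if every vertex has degree $r$ in it. *)

(* Defs.v *)
From mathcomp Require Import all_boot all_algebra.
From mathcomp Require Import finmap.

Set Implicit Arguments.
Unset Strict Implicit.
Unset Printing Implicit Defensive.

Local Open Scope fset_scope.

(* The symbol * is encoded as None. *)
Notation array f K := 'M[option int]_(f, K).

Section PDA.
Variables (K f : nat).
Implicit Types (P : array f K) (S : {fset int}) (s : int).

Definition cells P s : {set 'I_f * 'I_K} := [set c | P c.1 c.2 == Some s].

Definition blackburn P : Prop :=
  forall (j1 j2 : 'I_f) (k1 k2 : 'I_K) s,
    (j1, k1) <> (j2, k2) -> P j1 k1 = Some s -> P j2 k2 = Some s ->
    P j1 k2 = None /\ P j2 k1 = None.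

Record is_pda (Z : nat) S P : Prop := IsPDA {
  pda_K_gt0 : 0 < K;
  pda_f_gt0 : 0 < f;
  pda_entries : forall j k s, P j k = Some s -> s \in S;
  pda_stars : forall k, #|[set j | P j k == None]| = Z;
  pda_occurs : forall s, s \in S -> exists j k, P j k = Some s;
  pda_blackburn : blackburn P
}.

Definition pda_regular (g : nat) S P : Prop :=
  forall s, s \in S -> #|cells P s| = g.

Definition columns_of P s : {set 'I_K} :=
  [set k | [exists j, P j k == Some s]].

Definition star_out (F : {fset int}) P : array f K :=
  \matrix_(j, k)
    (if P j k is Some s then if s \in F then None else Some s else None).

(* By the Blackburn property the two occurrences of s lie in distinct columns. *)
Lemma card_columns_of Z S P :
  is_pda Z S P -> pda_regular 2 S P ->
  forall s, s \in S -> #|columns_of P s| = 2.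
Proof.
move=> hP hr s sS; rewrite -(hr s sS).
have -> : columns_of P s = [set c.2 | c in cells P s].
  apply/setP => k; rewrite inE; apply/existsP/imsetP.
    by case=> j hj; exists (j, k); rewrite ?inE.
  by case=> -[j k'] /[!inE] /= hj ->; exists j.
apply: card_in_imset => -[j1 k1] [j2 k2] /[!inE] /= /eqP h1 /eqP h2 ek.
apply/eqP; apply/negPn/negP => /eqP ne.
by have [] := pda_blackburn hP ne h1 h2; rewrite -ek h1.
Qed.

End PDA.

(* Finite loopless multigraph on the vertex set V: the edges are labels, and
   ends e is the unordered pair of endpoints of e, so that distinct labels with
   the same endpoints are distinct parallel edges. *)
Record multigraph (V : finType) (E : choiceType) := Multigraph {
  edges : {fset E};
  ends : E -> {set V};
  card_ends : forall e, e \in edges -> #|ends e| = 2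
}.

Section Multigraph.
Variables (V : finType) (E : choiceType).
Implicit Types (G H : multigraph V E).

Definition degree G (v : V) : nat :=
  #|` [fset e in edges G | v \in ends G e]|.

Definition isolated G (v : V) : Prop :=
  forall e, e \in edges G -> v \notin ends G e.

Definition graph_regular (r : nat) G : Prop := forall v, degree G v = r.

Definition spanning_subgraph H G : Prop :=
  [/\ edges H `<=` edges G,
      forall e, e \in edges H -> ends H e = ends G e
    & forall v, ~ isolated H v].

End Multigraph.

(* The edge e(s) is the label s itself; it joins the two columns containing s. *)
Definition pda_graph (n Z : nat) (S : {fset int}) (P : array n n)
    (hP : is_pda Z S P) (hreg : pda_regular 2 S P) : multigraph 'I_n int :=
  Multigraph (card_columns_of hP hreg).

(* Main.v *)
(* By the Blackburn property an integer occurs at most once in a column, so the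
   number of cells of column k carrying an integer of Sr is the number of edges
   e(s), s in Sr, incident to the vertex k, i.e. its degree r in the subgraph. *)

Require Import Defs.
From mathcomp Require Import all_boot all_algebra.
From mathcomp Require Import finmap.

Local Open Scope fset_scope.

Lemma star_out_someP f K (F : {fset int}) (P : array f K) j k s :
  star_out F P j k = Some s <-> P j k = Some s /\ s \notin F.
Proof.
rewrite mxE; case: (P j k) => [t|]; last by split=> [|[]].
case: ifP => tF; split=> //.
- by case=> -[<-]; rewrite tF.
- by case=> <-; rewrite tF.
by case.
Qed.

(** For two cells of one column, the crossing cells in the Blackburn property are the two cells
    themselves, so they would hold both [s] and a star. *)
Lemma blackburn_column_inj {f K} {P : array f K} {j1 j2 k s} :
  blackburn P -> P j1 k = Some s -> P j2 k = Some s -> j1 = j2.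
Proof.
move=> bP h1 h2; apply/eqP/negPn/negP => /eqP ne.
have ne' : (j1, k) <> (j2, k) by case.
by have [] := bP _ _ _ _ _ ne' h1 h2; rewrite h1.
Qed.

(** These are the rows in which column [k] gains a star under [star_out F]. *)
Definition entry_in {f K} (P : array f K) (F : {fset int}) k : {set 'I_f} :=
  [set j | if P j k is Some s then s \in F else false].

Lemma card_entry_in f K (P : array f K) (F : {fset int}) k :
  blackburn P ->
  #|entry_in P F k| = #|` [fset s in F | k \in columns_of P s]|.
Proof.
(* Reading off entries is the bijection from rows to labels. The default 0 is harmless: on
   [entry_in P F k] the entry is always an integer. *)
move=> bP; pose v j : int := odflt (Posz 0) (P j k).
have vP j : j \in entry_in P F k -> P j k = Some (v j) /\ v j \in F.
  by rewrite inE /v; case: (P j k).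
have -> : [fset s in F | k \in columns_of P s] =
          [fset v j | j in entry_in P F k].
  apply/fsetP => s; rewrite !inE /=; apply/andP/imfsetP => /=.
    case=> sF /existsP[j /eqP Pj].
    by exists j; rewrite ?inE /v Pj.
  case=> j /vP[Pj vF] ->; split=> //.
  by apply/existsP; exists j; rewrite Pj.
rewrite card_in_imfset /= -?cardE // => j1 j2 /vP[P1 _] /vP[P2 _] ev.
by apply: (blackburn_column_inj bP P1); rewrite ev.
Qed.

Lemma card_star_out_column f K (P : array f K) (F : {fset int}) k :
  blackburn P ->
  #|[set j | star_out F P j k == None]| =
    (#|[set j | P j k == None]| + #|` [fset s in F | k \in columns_of P s]|)%N.
Proof.
(* The sum becomes the size of a union plus that of an intersection, which is empty since an old
   star holds no integer. *)
move=> bP; rewrite -card_entry_in // -cardsUI.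
have -> : [set j | P j k == None] :&: entry_in P F k = set0.
  by apply/setP => j; rewrite !inE; case: (P j k).
rewrite cards0 addn0; apply: eq_card => j; rewrite !inE mxE.
by case: (P j k) => [s|] //=; case: ifP.
Qed.

(** Integer cells of the new array already held the same integer in [P], and stars of [P] remain
    stars. *)
Lemma blackburn_star_out f K (P : array f K) (F : {fset int}) :
  blackburn P -> blackburn (star_out F P).
Proof.
move=> bP j1 j2 k1 k2 s ne /star_out_someP[h1 _] /star_out_someP[h2 _].
by have [e1 e2] := bP _ _ _ _ _ ne h1 h2; rewrite !mxE e1 e2.
Qed.

(** The condition on [F] is [r]-regularity stated without graphs: each column meets exactly [r]
    labels of [F]. *)
Lemma is_pda_star_out f K Z r (S F : {fset int}) (P : array f K) :
  is_pda Z S P ->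
  (forall k, #|` [fset s in F | k \in columns_of P s]| = r) ->
  is_pda (Z + r) (S `\` F) (star_out F P).
Proof.
case=> K0 f0 entP starP occP bP degF; split=> //.
- by move=> j k s /star_out_someP[/entP sS sF]; rewrite inE sF.
- by move=> k; rewrite card_star_out_column // starP degF.
- move=> s; rewrite inE => /andP[sF /occP[j [k Pjk]]].
  by exists j, k; apply/star_out_someP.
- exact: blackburn_star_out.
Qed.

Lemma pda_regular_star_out f K g (S F : {fset int}) (P : array f K) :
  pda_regular g S P -> pda_regular g (S `\` F) (star_out F P).
Proof.
move=> reg s; rewrite inE => /andP[sF /reg <-].
apply: eq_card => -[j k]; rewrite !inE /=.
by apply/eqP/eqP => [/star_out_someP[]|Pjk] //; apply/star_out_someP.
Qed.

Theorem theorem4 (n z r : nat) (S Sr : {fset int}) (P : array n n)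
    (hP : is_pda z S P) (hreg : pda_regular 2 S P)
    (H : multigraph 'I_n int)
    (hspan : spanning_subgraph H (pda_graph hP hreg))
    (hr : graph_regular r H)
    (hSr : edges H = Sr) :
  is_pda (z + r) (S `\` Sr) (star_out Sr P) /\
  pda_regular 2 (S `\` Sr) (star_out Sr P).
Proof.
split; last exact: pda_regular_star_out.
apply: is_pda_star_out => // k; rewrite -(hr k) /degree hSr.
case: hspan => _ endsE _; congr #|` _|; apply/fsetP => s; rewrite !inE /=.
(* [H] has its own [ends], known to agree with [columns_of P] only on the edges of [H], hence the
   case split on membership in [Sr]. *)
by case sSr: (s \in Sr); rewrite //= endsE ?hSr // inE.
Qed.
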